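(* For every integer $n\ge4$, $$\tau(n,n-2)=\begin{cases}2n-10&\text{if }n\ge9,\\ n-1&\text{if }4\le n\le8.\end{cases}$$
   Context: A betweenness structure is a pair $\mathcal{B}=(X,\beta)$ where $X$ is a nonempty finite set and $\beta\subseteq X^3$; write $(x\ y\ z)$ for $(x,y,z)\in\beta$. All betweenness structures are assumed to be almost-metrizable, i.e. for all $x,y,z,w\in X$: (P1) $(x\ x\ z)$; (P2) $(x\ y\ z)\Rightarrow(z\ y\ x)$; (P3) $(x\ y\ z)\wedge(y\ x\ z)\Rightarrow x=y$; (P4) $(x\ y\ z)\wedge(x\ w\ y)\Rightarrow(x\ w\ z)\wedge(w\ y\ z)$. The order of $\mathcal{B}$ is $|X|$. A set of three distinct points is collinear if some ordering of it is in $\beta$; otherwise it is a triangle. The co-size of $\mathcal{B}$ is its number of triangles. $B(n,m)$ is the set of betweenness structures of order $n$ and co-size $m$, and $\tau(n,k)=\min\{m>k:B(n,m)\ne\emptyset\}$. *)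

(* Defs.v *)
From mathcomp Require Import all_boot.

Set Implicit Arguments.
Unset Strict Implicit.
Unset Printing Implicit Defensive.

(* "Betweenness structure" always means almost-metrizable here, so the axioms
   (P1)-(P4) are part of the structure. *)
Record betweenness := Betweenness {
  point :> finType;
  beta : {set point * point * point};
  point_nonempty : 0 < #|point|;
  beta_P1 : forall x z : point, (x, x, z) \in beta;
  beta_P2 : forall x y z : point, (x, y, z) \in beta -> (z, y, x) \in beta;
  beta_P3 : forall x y z : point,
    (x, y, z) \in beta -> (y, x, z) \in beta -> x = y;
  beta_P4 : forall x y z w : point,
    (x, y, z) \in beta -> (x, w, y) \in beta ->
    (x, w, z) \in beta /\ (w, y, z) \in beta }.

Definition bt_order (B : betweenness) : nat := #|B|.

(* Only meant for sets S of three points; then x, y and z below are necessarily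
   distinct. *)
Definition collinear (B : betweenness) (S : {set B}) : bool :=
  [exists x : B, exists y : B, exists z : B,
     (S == [set x; y; z]) && ((x, y, z) \in beta B)].

Definition triangle (B : betweenness) (S : {set B}) : bool :=
  (#|S| == 3) && ~~ collinear S.

Definition cosize (B : betweenness) : nat := #|[set S : {set B} | triangle S]|.

Definition in_B (n m : nat) (B : betweenness) : Prop :=
  bt_order B = n /\ cosize B = m.

(* tau(n, k) = t.  The minimum of a set that may be empty is rendered as a
   relation, so that it asserts in particular that the minimum exists. *)
Definition is_tau (n k t : nat) : Prop :=
  [/\ k < t,
      exists B : betweenness, in_B n t B
    & forall m : nat, k < m -> (exists B : betweenness, in_B n m B) -> t <= m].

(* Main.v *)
Require Import Defs.
From mathcomp Require Import all_boot zify_ssreflect.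
Import SsreflectZifyInstances.Exports.

(** If all triangles share a pair of points there are at most n - 2 of them.
    Otherwise there are either three triangles on four points ("fan"), or two
    triangles with exactly one common point ("bowtie"), or two disjoint
    triangles; call such a configuration a core.  A set of n points containing a
    core has at least 2n - 10 triangles, by induction on n: if a point outside
    the core lies in two triangles, remove it.  Otherwise every point outside
    the core lies in at most one triangle, and this is impossible on a bounded
    number of points: no structure on 9 points has such a fan, none on 8 points
    without fan has such a bowtie, and none on 7 points with neither has two
    disjoint triangles; on 7 and 8 points one uses moreover that there are fewer
    than 2n - 10 triangles.  These finitely many cases are excluded by a
    backtracking search over the middle points of all triples.

    For the equality, take points on a line and double one or two of them. *)

Set Implicit Arguments.
Unset Strict Implicit.
Unset Printing Implicit Defensive.

(** * Verified backtracking *)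

Notation constraint V := (seq V * (seq nat -> bool))%type.

(* [all] would evaluate both arguments of [&&] under call by value. *)
Fixpoint allc (T : Type) (a : pred T) (s : seq T) : bool :=
  if s is x :: s' then if a x then allc a s' else false else true.

Lemma allcE (T : Type) (a : pred T) (s : seq T) : allc a s = all a s.
Proof. by elim: s => //= x s ->; case: (a x). Qed.

(* [env] holds the values chosen so far, the latest first; the scope of a
   constraint is a list of offsets into [env]. *)
Fixpoint search (cs : seq (seq (constraint nat))) (env : seq nat) : bool :=
  if cs is c :: cs' then
    let try v :=
      let env' := v :: env in
      if allc (fun p => p.2 [seq nth 0 env' o | o <- p.1]) c
      then search cs' env' else false in
    if try 0 then true else if try 1 then true else if try 2 then true else try 3
  else true.

Lemma search_cons c cs env v :
    v < 4 -> allc (fun p => p.2 [seq nth 0 (v :: env) o | o <- p.1]) c ->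
  search cs (v :: env) -> search (c :: cs) env.
Proof. by move: v => [|[|[|[|//]]]] _ /= -> ->; repeat case: ifP. Qed.

(* Every constraint is checked as soon as the last variable of its scope is
   assigned. *)
Definition compile (V : eqType) (vars : seq V) (cons : seq (constraint V)) :=
  let ics :=
    [seq (let s := [seq index v vars | v <- c.1] in (foldr maxn 0 s, s, c.2))
      | c <- cons] in
  [seq [seq ([seq t - i | i <- c.1.2], c.2) | c <- ics & c.1.1 == t]
    | t <- iota 0 (size vars)].

Lemma leq_foldr_maxn (s : seq nat) (i : nat) : i \in s -> i <= foldr maxn 0 s.
Proof.
elim: s => //= x s IH; rewrite inE leq_max => /predU1P[->|/IH->];
  by rewrite ?leqnn ?orbT.
Qed.

(** The search can always follow the branch that picks [val] at each variable. By contraposition, a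
    search that evaluates to [false] rules out every valuation meeting the constraints. *)
Lemma search_complete (V : eqType) (vars : seq V) (cons : seq (constraint V))
    (val : V -> nat) :
    (forall v, val v < 4) -> all (fun c => c.2 (map val c.1)) cons ->
  search (compile vars cons) [::].
Proof.
move=> val4 consP; case: vars => [//|v0 vars0]; set vars := v0 :: vars0.
pose F i := val (nth v0 vars i).
rewrite /compile; set ics := map _ cons; set G := fun t => map _ (filter _ ics).
(* The claim is generalised to an intermediate state: [t] values are chosen, stored in reverse
   order, and [k] variables are left. *)
suff gen k t : t + k = size vars ->
    search [seq G u | u <- iota t k] (rev (mkseq F t)) by exact: (gen _ 0).
elim: k t => [//|k IH] t tk.
have envE : F t :: rev (mkseq F t) = rev (mkseq F t.+1).
  by rewrite /mkseq -addn1 iotaD map_cat rev_cat.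
have okt : allc (fun p : constraint nat =>
    p.2 [seq nth 0 (F t :: rev (mkseq F t)) o | o <- p.1]) (G t).
  rewrite allcE /G all_map all_filter /ics all_map.
  apply: sub_all consP => -[sc pr] /= scP; apply/implyP => /eqP mx.
  rewrite -!map_comp.
  suff -> : [seq nth 0 (F t :: rev (mkseq F t)) (t - index v vars) | v <- sc]
      = map val sc by [].
  apply/eq_in_map => v vs.
  (* This keeps the truncated subtraction [t - index v vars] exact; as [t < size vars], it also
     shows that [v] occurs in [vars]. *)
  have le_vt : index v vars <= t.
    by rewrite -mx; apply: leq_foldr_maxn; apply: map_f.
  rewrite envE nth_rev ?size_mkseq; last lia.
  rewrite (_ : _ - _ = index v vars); last lia.
  rewrite nth_mkseq; last lia.
  by rewrite /F nth_index // -index_mem; lia.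
apply: search_cons (val4 _) okt _.
by rewrite envE; apply: IH; lia.
Qed.

(** * Triples of points *)

Notation triple := (nat * nat * nat)%type.

Definition pairs m : seq (nat * nat) :=
  [seq (i, j) | j <- iota 0 m, i <- iota 0 j].

(** In this order all triples among the first points precede those through a later point, so the
    search completes the structure on an initial segment before it adds a point. *)
Definition triples m : seq triple := [seq (p, k) | k <- iota 0 m, p <- pairs k].

Definition faces (t : triple) (d : nat) : seq triple :=
  let: (a, b, c) := t in [:: (a, b, c); (a, b, d); (a, c, d); (b, c, d)].

Definition quads m : seq (seq triple) :=
  [seq faces t d | d <- iota 0 m, t <- triples d].

Definition points (t : triple) : seq nat := let: (i, j, k) := t in [:: i; j; k].

Lemma mem_pairs m i j : ((i, j) \in pairs m) = (i < j < m).
Proof.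
apply/allpairsPdep/idP => [[j' [i' []]]|/andP[ij jm]].
  by rewrite !mem_iota => ? ? [-> ->]; lia.
by exists j, i; rewrite !mem_iota /=; split.
Qed.

Lemma mem_triples m i j k : ((i, j, k) \in triples m) = (i < j < k) && (k < m).
Proof.
apply/allpairsPdep/idP => [[k' [[i' j'] []]]|/andP[ijk km]].
  by rewrite mem_iota mem_pairs => ? ? [-> -> ->]; lia.
by exists k, (i, j); rewrite mem_iota mem_pairs /=; split.
Qed.

Lemma pairs_uniq m : uniq (pairs m).
Proof.
apply: allpairs_uniq_dep => [|j _|]; rewrite ?iota_uniq //.
by move=> [j i] [j' i'] _ _ /= [-> ->].
Qed.

Lemma triples_uniq m : uniq (triples m).
Proof.
apply: allpairs_uniq_dep => [|k _|]; rewrite ?iota_uniq ?pairs_uniq //.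
by move=> [k p] [k' p'] _ _ /= [-> ->].
Qed.

Lemma triplesS m : triples m.+1 = triples m ++ [seq (p, m) | p <- pairs m].
Proof. by rewrite /triples -addn1 iotaD map_cat flatten_cat /= cats0. Qed.

Lemma sub_triples m n : m <= n -> {subset triples m <= triples n}.
Proof. by move=> mn [[i j] k]; rewrite !mem_triples; lia. Qed.

Lemma points_sorted m t : t \in triples m -> sorted ltn (points t).
Proof. by move: t => [[i j] k]; rewrite mem_triples /=; lia. Qed.

Lemma points_lt m t p : t \in triples m -> p \in points t -> p < m.
Proof. by move: t => [[i j] k]; rewrite mem_triples /= !inE; lia. Qed.

Lemma points_inj m t t' : t \in triples m -> t' \in triples m ->
  points t =i points t' -> t = t'.
Proof.
move=> /points_sorted st /points_sorted st' /(irr_sorted_eq ltn_trans ltnn st st').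
by move: t t' {st st'} => [[i j] k] [[i' j'] k'] [-> -> ->].
Qed.

(* A triple i < j < k has value 0 if it is a triangle, and otherwise 1, 2 or 3
   according to whether i, j or k is its middle point.  A list [vs] holds the
   values of the faces of {0, 1, 2, 3} in the order of [faces], in which the
   face of x, y, z has index x + y + z - 3. *)
Definition decode (vs : seq nat) (x y z : nat) : bool :=
  nth 0 vs (x + y + z - 3) == ((x < y) + (z < y)).+1.

(** The encoding names at most one middle point per triple, which builds in (P2) and (P3); what is
    tested is (P4) on four distinct points. *)
Definition metrizable4 (vs : seq nat) : bool :=
  all (fun p =>
    let: x := nth 0 p 0 in let: y := nth 0 p 1 in
    let: z := nth 0 p 2 in let: w := nth 0 p 3 in
    decode vs x y z && decode vs x w y ==> decode vs x w z && decode vs w y z)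
  (permutations (iota 0 4)).

(** Any three of the four faces share a vertex, so a third triangle would complete a fan. *)
Definition few_triangles4 (vs : seq nat) : bool :=
  metrizable4 vs && (count_mem 0 vs <= 2).

(** All 256 value lists are evaluated once, which spares the search a run through 24 permutations at
    every quadruple. *)
Definition tabulate (f : seq nat -> bool) :=
  [seq [seq [seq [seq f [:: a; b; c; d] | d <- iota 0 4] | c <- iota 0 4]
    | b <- iota 0 4] | a <- iota 0 4].

Definition lookup (t : seq (seq (seq (seq bool)))) (vs : seq nat) : bool :=
  if vs is [:: a; b; c; d] then
    nth true (nth [::] (nth [::] (nth [::] t a) b) c) d
  else true.

Lemma lookup_tabulate f a b c d : a < 4 -> b < 4 -> c < 4 -> d < 4 ->
  lookup (tabulate f) [:: a; b; c; d] = f [:: a; b; c; d].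
Proof.
by move=> a4 b4 c4 d4; rewrite /lookup /tabulate;
  do 4! rewrite (nth_map 0) ?size_iota // nth_iota // add0n.
Qed.

Lemma lookup_faces f (v : triple -> nat) t d : (forall t, v t < 4) ->
  lookup (tabulate f) (map v (faces t d)) = f (map v (faces t d)).
Proof. by move=> v4; case: t => [[a b] c]; apply: lookup_tabulate. Qed.

Definition meet_from (c : nat) (t t' : triple) : bool :=
  has (fun p => (c <= p) && (p \in points t')) (points t).

Definition meet_once (t t' : triple) : bool :=
  count (fun p => p \in points t') (points t) == 1.

(* The triples in [core] are triangles, the quadruples satisfy [f], triples
   related by [sh] are not both triangles, there are at most [b] triangles, and
   the points from [c] on are sorted, to break the symmetry between them, by
   their position relative to the points 0 and 1. *)
Definition core_constraints (m c : nat) (core : seq triple)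
    (f : seq nat -> bool) (sh : rel triple) (b : option nat) :
    seq (constraint triple) :=
  let tab := tabulate f in
  let ts := triples m in
  [seq ([:: t], fun vs => if vs is [:: 0] then true else false) | t <- core]
  ++ [seq ([:: (0, 1, p); (0, 1, p.+1)],
           fun vs => if vs is [:: v; v'] then v <= v' else true)
       | p <- iota c (m - c).-1]
  ++ [seq (q, lookup tab) | q <- quads m]
  ++ [seq ([:: t.1; t.2], fun vs => if vs is [:: 0; 0] then false else true)
       (* Pairing [t2] only with earlier triples lists each unordered pair once. *)
       | t <- [seq (t1, t2) | t2 <- ts, t1 <- take (index t2 ts) ts]
       & sh t.1 t.2]
  ++ (if b is Some n then
        (* The bound is tested each time a point is completed, on the triples known so far. *)
        [seq (triples p, fun vs => count_mem 0 vs <= n) | p <- iota 1 m]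
      else [::]).

Definition core_search m c core f sh b : bool :=
  search (compile (triples m) (core_constraints m c core f sh b)) [::].

(** * The three cores and their refutation by computation *)

Definition fan : seq triple := [:: (0, 1, 2); (0, 1, 3); (0, 2, 3)].
Definition bowtie : seq triple := [:: (0, 1, 2); (0, 3, 4)].
Definition disjoint_pair : seq triple := [:: (0, 1, 2); (3, 4, 5)].

(** The bound 3 is the largest number of triangles below 2 * 7 - 10; the bound 5 on 8 points arises
    in the same way. *)
Lemma fan_search7 :
  core_search 7 4 fan metrizable4 (meet_from 4) (Some 3) = false.
Proof. by vm_compute. Qed.

Lemma fan_search8 :
  core_search 8 4 fan metrizable4 (meet_from 4) (Some 5) = false.
Proof. by vm_compute. Qed.

Lemma fan_search9 :
  core_search 9 4 fan metrizable4 (meet_from 4) None = false.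
Proof. by vm_compute. Qed.

Lemma bowtie_search7 :
  core_search 7 5 bowtie few_triangles4 (meet_from 5) (Some 3) = false.
Proof. by vm_compute. Qed.

Lemma bowtie_search8 :
  core_search 8 5 bowtie few_triangles4 (meet_from 5) None = false.
Proof. by vm_compute. Qed.

(** Here [meet_once] forbids bowties among all seven points, core points included. *)
Lemma disjoint_pair_search7 :
  core_search 7 6 disjoint_pair few_triangles4 meet_once None = false.
Proof. by vm_compute. Qed.

(** * Values of triples in a betweenness structure *)

Section Geometry.

Variable B : betweenness.
Implicit Types (x y z w : B) (S Y : {set B}) (s : seq B).

Local Notation bt x y z := ((x, y, z) \in beta B).

Lemma bt_sym x y z : bt x y z = bt z y x.
Proof. by apply/idP/idP; apply: beta_P2. Qed.

Lemma bt_middle x y z : bt x y z -> bt y x z -> x = y.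
Proof. exact: beta_P3. Qed.

Definition tri x y z : bool := ~~ [|| bt y x z, bt x y z | bt x z y].

Definition value x y z : nat :=
  if bt y x z then 1 else if bt x y z then 2 else if bt x z y then 3 else 0.

Lemma value_lt4 x y z : value x y z < 4.
Proof. by rewrite /value; do ?case: ifP. Qed.

Lemma value_eq0 x y z : (value x y z == 0) = tri x y z.
Proof. by rewrite /value /tri; do ?case: ifP. Qed.

Lemma value_eq1 x y z : (value x y z == 1) = bt y x z.
Proof. by rewrite /value; do ?case: ifP. Qed.

(** By (P3) at most one of three distinct points is a middle point, so the order of the tests in
    [value] is immaterial. *)
Lemma value_eq2 x y z : x != y -> (value x y z == 2) = bt x y z.
Proof.
move=> xy; rewrite /value; case: ifP => [yxz|_]; last by do ?case: ifP.
by apply/esym/negbTE/negP => /(bt_middle yxz) yx; rewrite yx eqxx in xy.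
Qed.

Lemma value_eq3 x y z : x != z -> y != z -> (value x y z == 3) = bt x z y.
Proof.
move=> xz yz; rewrite /value.
case: ifP => [yxz|_]; last case: ifP => [xyz|_]; last by case: ifP.
  apply/esym/negbTE/negP => xzy; move: xz.
  by rewrite (bt_middle (beta_P2 yxz) xzy) eqxx.
apply/esym/negbTE/negP => xzy; move: yz.
by rewrite (bt_middle (beta_P2 xyz) (beta_P2 xzy)) eqxx.
Qed.

Lemma triC x y z : tri x y z = tri y x z.
Proof. by rewrite /tri (bt_sym x z y); case: (bt y x z); case: (bt x y z). Qed.

Lemma triCA x y z : tri x y z = tri x z y.
Proof. by rewrite /tri (bt_sym z x y); case: (bt y x z); case: (bt x y z);
  case: (bt x z y). Qed.

Lemma decode_faces a b c d (x y z : nat) : uniq [:: a; b; c; d] ->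
    x < 4 -> y < 4 -> z < 4 -> uniq [:: x; y; z] ->
  let P := nth a [:: a; b; c; d] in
  decode [:: value a b c; value a b d; value a c d; value b c d] x y z =
    bt (P x) (P y) (P z).
Proof.
rewrite /= !inE !negb_or andbT => /and3P[/and3P[ab ac ad] /andP[bc bd] cd].
have := (ab, ac, ad, bc, bd, cd); rewrite !(eq_sym a) !(eq_sym b) !(eq_sym c).
move=> [[[[[ba ca] da] cb] db] dc].
move: x y z => [|[|[|[|x]]]] [|[|[|[|y]]]] [|[|[|[|z]]]] // _ _ _ _ /=;
  rewrite /decode /= ?value_eq1 ?value_eq2 ?value_eq3 //; exact: bt_sym.
Qed.

Lemma metrizable4_faces a b c d : uniq [:: a; b; c; d] ->
  metrizable4 [:: value a b c; value a b d; value a c d; value b c d].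
Proof.
move=> abcd; apply/allP => p; rewrite mem_permutations => pP.
have p4 q : q \in p -> q < 4 by rewrite (perm_mem pP) mem_iota.
move: (perm_uniq pP) (perm_size pP) p4; rewrite iota_uniq.
move: p {pP} => [|x [|y [|z [|w [|? ?]]]]] // pu _ p4.
move: pu => /=; rewrite !inE !negb_or !andbT.
move=> /and3P[/and3P[xy xz xw] /andP[yz yw] zw].
have [x4 y4 z4 w4] : [/\ x < 4, y < 4, z < 4 & w < 4].
  by split; apply: p4; rewrite !inE eqxx ?orbT.
have [wy wz] : w != y /\ w != z by rewrite ![w == _]eq_sym.
by rewrite !(decode_faces abcd) //= ?inE ?negb_or ?xy ?xz ?xw ?yz ?wz ?wy //;
   apply/implyP => /andP[xyz xwy]; apply/andP; apply: beta_P4 xyz xwy.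
Qed.

Lemma triangle3 x y z : uniq [:: x; y; z] -> triangle [set x; y; z] = tri x y z.
Proof.
move=> u; have c3 : #|[set x; y; z]| = 3.
  have -> : [set x; y; z] = [set u in [:: x; y; z]].
    by apply/setP => v; rewrite !inE orbA.
  by rewrite cardsE (card_uniqP u).
rewrite /triangle c3 eqxx /= /tri; congr (~~ _).
apply/existsP/idP => [[a /existsP[b /existsP[c /andP[/eqP E abc]]]]|].
  have := c3; rewrite E (eq_card (B := mem [:: a; b; c])); last first.
    by move=> v; rewrite !inE orbA.
  move/card_uniqP; rewrite /= !inE negb_or andbT => /andP[/andP[ab ac] bc].
  have [] : [/\ a \in [set x; y; z], b \in [set x; y; z] & c \in [set x; y; z]].
    by rewrite E !inE !eqxx ?orbT.
  move: ab ac bc abc; rewrite !inE.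
  (* Of the 27 ways to identify a, b, c with x, y, z, distinctness leaves the six permutations. *)
  by move=> ab ac bc abc /orP[/orP[]|] /eqP Ea /orP[/orP[]|] /eqP Eb
    /orP[/orP[]|] /eqP Ec;
    move: ab ac bc abc; rewrite Ea Eb Ec ?eqxx // => _ _ _;
    rewrite 1?bt_sym => ->; rewrite ?orbT.
case/or3P => h.
- exists y; apply/existsP; exists x; apply/existsP; exists z; rewrite h andbT.
  by rewrite [[set y; x]]setUC.
- by exists x; apply/existsP; exists y; apply/existsP; exists z; rewrite h andbT.
- exists x; apply/existsP; exists z; apply/existsP; exists y; rewrite h andbT.
  by rewrite setUAC.
Qed.

(** * Triangles inside a set of points *)

Definition triangles Y : {set {set B}} := [set S | triangle S & S \subset Y].

Lemma trianglesS Y Y' : Y \subset Y' -> triangles Y \subset triangles Y'.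
Proof.
move=> YY'; apply/subsetP => S; rewrite !inE => /andP[-> /=].
by move/subset_trans; apply.
Qed.

Lemma card_triangles S Y : S \in triangles Y -> #|S| = 3.
Proof. by rewrite inE => /andP[/andP[/eqP]]. Qed.

Lemma triangles_setD1 Y x :
  #|triangles Y| =
    #|triangles (Y :\ x)| + #|[set S in triangles Y | x \in S]|.
Proof.
rewrite -(cardsID [set S : {set B} | x \notin S] (triangles Y)); congr (_ + _).
  apply: eq_card => S; rewrite !inE subsetD1; by case: (triangle S).
by apply: eq_card => S; rewrite !inE negbK andbC.
Qed.

Variable x0 : B.

Definition pt_value s (t : triple) : nat :=
  let: (i, j, k) := t in value (nth x0 s i) (nth x0 s j) (nth x0 s k).

Definition pt_set s (t : triple) : {set B} := [set x in map (nth x0 s) (points t)].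

Lemma pt_value_lt4 s t : pt_value s t < 4.
Proof. by move: t => [[i j] k]; apply: value_lt4. Qed.

Lemma pt_set_triangle s t Y : uniq s -> {subset s <= Y} ->
    t \in triples (size s) ->
  (pt_set s t \in triangles Y) = (pt_value s t == 0).
Proof.
move: t => [[i j] k] us sY; rewrite mem_triples => ijk.
have [si sj sk] : [/\ i < size s, j < size s & k < size s] by split; lia.
have E : pt_set s (i, j, k) = [set nth x0 s i; nth x0 s j; nth x0 s k].
  by apply/setP => v; rewrite !inE orbA.
rewrite inE {1}E triangle3 ?value_eq0; last first.
  by rewrite /= !inE !nth_uniq //; lia.
rewrite [X in _ && X](_ : _ = true) ?andbT //.
apply/subsetP => v; rewrite E !inE => /orP[/orP[]|] /eqP->;
  by apply: sY; apply: mem_nth.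
Qed.

Lemma mem_pt_set s t p : uniq s -> t \in triples (size s) -> p < size s ->
  (nth x0 s p \in pt_set s t) = (p \in points t).
Proof.
move=> us ts ps; rewrite inE.
apply/mapP/idP => [[q qt /eqP]|pt]; last by exists p.
by rewrite nth_uniq // => [/eqP->|]; last exact: points_lt ts qt.
Qed.

Lemma pt_set_inj s : uniq s -> {in triples (size s) &, injective (pt_set s)}.
Proof.
move=> us t t' ts ts' E; apply: (points_inj ts ts') => p.
apply/idP/idP => pt.
  have ps := points_lt ts pt.
  by rewrite -(mem_pt_set us ts') // -E mem_pt_set.
have ps := points_lt ts' pt.
by rewrite -(mem_pt_set us ts) // E mem_pt_set.
Qed.

Lemma count_triangles s Y m : uniq s -> {subset s <= Y} -> m <= size s ->
  count_mem 0 (map (pt_value s) (triples m)) <= #|triangles Y|.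
Proof.
move=> us sY ms; rewrite count_map -size_filter.
set L := filter _ _.
have Ls t : t \in L -> t \in triples (size s) /\ pt_value s t = 0.
  by rewrite mem_filter => /andP[/eqP ? /(sub_triples ms)].
rewrite -(size_map (pt_set s)); set M := map _ L.
have uM : uniq M.
  rewrite map_inj_in_uniq ?filter_uniq ?triples_uniq //.
  by move=> t t' /Ls[? _] /Ls[? _]; apply: pt_set_inj.
rewrite -(card_uniqP uM); apply/subset_leq_card/subsetP => S.
move=> /mapP[t /Ls[ts t0] ->].
by rewrite pt_set_triangle // t0.
Qed.

(** This makes the co-size of a concrete structure a computable count over index triples. *)
Lemma cosize_count s : uniq s -> s =i B ->
  cosize B = count_mem 0 (map (pt_value s) (triples (size s))).
Proof.
move=> us sB; apply/eqP; rewrite eqn_leq; apply/andP; split; last first.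
  apply: leq_trans (count_triangles us (Y := setT) _ (leqnn _)) _ => [x|].
    by rewrite inE.
  by apply/subset_leq_card/subsetP => S; rewrite !inE => /andP[].
rewrite count_map -size_filter -(size_map (pt_set s)).
rewrite /cosize cardE; apply: uniq_leq_size (enum_uniq _) _ => S.
rewrite mem_enum inE => tS; have [/eqP S3 _] := andP tS.
(* The positions in [s] of the points of S, in increasing order, form the required triple. *)
pose P := [seq p <- iota 0 (size s) | nth x0 s p \in S].
have ES : S = [set x in map (nth x0 s) P].
  apply/setP => x; rewrite inE; apply/idP/mapP => [xS|[p]].
    have xs : x \in s by rewrite sB.
    exists (index x s); rewrite ?nth_index //.
    by rewrite mem_filter nth_index // xS mem_iota index_mem.
  by rewrite mem_filter => /andP[pS _] ->.
have uP : uniq (map (nth x0 s) P).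
  rewrite map_inj_in_uniq ?filter_uniq ?iota_uniq // => p q.
  rewrite !mem_filter !mem_iota => /andP[_ ps] /andP[_ qs] /eqP.
  by rewrite nth_uniq // => /eqP.
have P3 : size P = 3 by rewrite -S3 ES cardsE (card_uniqP uP) size_map.
have sP : sorted ltn P.
  by apply: sorted_filter (iota_ltn_sorted _ _); apply: ltn_trans.
have Ps p : p \in P -> p < size s by rewrite mem_filter mem_iota => /andP[_].
move: P P3 sP Ps ES {uP} => [|i [|j [|k [|? ?]]]] // _ sP Ps ES.
have ts : (i, j, k) \in triples (size s).
  by rewrite mem_triples; move: sP (Ps k); rewrite /= !inE eqxx !orbT; lia.
apply/mapP; exists (i, j, k); last exact: ES.
rewrite mem_filter ts andbT /= -[_ == 0]/(pt_value s (i, j, k) == 0).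
rewrite -(@pt_set_triangle s (i, j, k) setT) //; last by move=> x; rewrite inE.
by rewrite inE subsetT andbT /pt_set -ES.
Qed.

(** * From structures to the search *)

Lemma core_search_complete s m c core (f : seq nat -> bool) (sh : rel triple)
    b :
    uniq s -> size s = m -> all (fun t => pt_value s t == 0) core ->
    (forall p, c <= p -> p.+1 < m ->
       pt_value s (0, 1, p) <= pt_value s (0, 1, p.+1)) ->
    {in quads m, forall q, f (map (pt_value s) q)} ->
    {in triples m &, forall t t', t != t' -> sh t t' ->
       pt_value s t = 0 -> pt_value s t' = 0 -> False} ->
    (forall n, b = Some n -> #|triangles [set x in s]| <= n) ->
  core_search m c core f sh b.
Proof.
move=> us sm coreP sortP fP shP bP.
apply: (@search_complete _ _ _ (pt_value s)) => [t|]; first exact: pt_value_lt4.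
rewrite /core_constraints !all_cat; apply/and5P; split.
- by rewrite all_map; apply: sub_all coreP => t /= /eqP->.
- rewrite all_map; apply/allP => p; rewrite mem_iota => pm.
  by apply: (sortP p); lia.
- rewrite all_map; apply/allP => q qm; have := fP q qm.
  case/allpairsPdep: qm => d [t [_ _ ->]].
  by rewrite -(lookup_faces f t d (pt_value_lt4 s)).
- rewrite all_map all_filter; apply/allP => -[t t'].
  case/allpairsPdep=> u' [u [u'm utk [-> ->]]].
  have um := mem_take utk; have uu' : u != u'.
    apply/eqP => uu'; move: utk; by rewrite uu' in_take ?ltnn.
  apply/implyP => /= /(shP _ _ um u'm uu').
  by case: (pt_value s u) => // /(_ erefl); case: (pt_value s u') => // /(_ erefl).
- case: b bP => // n /(_ n erefl) bn; rewrite all_map; apply/allP => p /=.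
  rewrite mem_iota => pm; apply: leq_trans bn.
  apply: count_triangles => // [x|].
    by rewrite inE.
  by rewrite sm; lia.
Qed.

(** Tuples over a finite type make the existential a boolean, open to case distinction. *)
Definition has_core (core : seq triple) (c : nat) Y : bool :=
  [exists s : c.-tuple B,
    [&& uniq s, [set x in s] \subset Y & all (fun t => pt_value s t == 0) core]].

Lemma has_coreP core c Y :
  reflect (exists s, [/\ uniq s, size s = c, {subset s <= Y}
                      & all (fun t => pt_value s t == 0) core])
          (has_core core c Y).
Proof.
apply: (iffP existsP) => [[s /and3P[us /subsetP sY coreP]]|[s [us sc sY coreP]]].
  exists s; split=> //; first exact: size_tuple.
  by move=> x xs; apply: sY; rewrite inE.
have sc' : size s == c by rewrite sc.
exists (Tuple sc'); rewrite /= us coreP andbT.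
by apply/subsetP => x; rewrite inE; apply: sY.
Qed.

Lemma pt_value_catl s l t : all (fun p => p < size s) (points t) ->
  pt_value (s ++ l) t = pt_value s t.
Proof.
by move: t => [[i j] k] /= /and4P[si sj sk _]; rewrite !nth_cat si sj sk.
Qed.

Definition star Y x : {set {set B}} := [set S in triangles Y | x \in S].

(** The core is extended by [m - c] arbitrary further points of [Y]. Their order is free, so they
    may be sorted as the symmetry-breaking constraints demand; [1 < c] places the reference points 0
    and 1 in the core. *)
Lemma core_search_extension core c m (f : seq nat -> bool) (sh : rel triple) b
    Y s :
    1 < c -> c <= m <= #|Y| -> {subset core <= triples c} ->
    uniq s -> size s = c -> {subset s <= Y} ->
    all (fun t => pt_value s t == 0) core ->
    (forall l, uniq l -> size l = m -> {subset l <= Y} ->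
       {in quads m, forall q, f (map (pt_value l) q)}) ->
    (forall l, uniq l -> size l = m -> {subset l <= Y} ->
       (forall p, c <= p < m -> #|star Y (nth x0 l p)| <= 1) ->
       {in triples m &, forall t t', t != t' -> sh t t' ->
         pt_value l t = 0 -> pt_value l t' = 0 -> False}) ->
    (forall n, b = Some n -> #|triangles Y| <= n) ->
    (forall x, x \in Y -> x \notin s -> #|star Y x| <= 1) ->
  core_search m c core f sh b.
Proof.
move=> c1 /andP[cm mY] corec us sc sY coreP fP shP bP degP.
pose key x := value (nth x0 s 0) (nth x0 s 1) x.
pose e := take (m - c) (enum (Y :\: [set x in s])).
pose l := sort (fun x y => key x <= key y) e.
have eP x : x \in l -> (x \in Y) && (x \notin s).
  by rewrite mem_sort => /mem_take; rewrite mem_enum !inE andbC.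
have ul : uniq l by rewrite sort_uniq take_uniq // enum_uniq.
have sl : size l = m - c.
  rewrite size_sort size_takel // -cardE cardsD.
  rewrite (setIidPr _); last by apply/subsetP => x; rewrite inE; apply: sY.
  by rewrite cardsE (card_uniqP us) sc leq_sub2r.
have usl : uniq (s ++ l).
  rewrite cat_uniq us ul andbT; by apply/hasPn => x /eP /andP[].
have ssl : size (s ++ l) = m by rewrite size_cat sc sl subnKC.
have slY : {subset s ++ l <= Y}.
  by move=> x; rewrite mem_cat => /orP[/sY|/eP /andP[]].
apply: (core_search_complete usl ssl).
- apply/allP => t tc; rewrite pt_value_catl ?(allP coreP) //.
  by apply/allP => p; rewrite sc; apply: points_lt (corec t tc).
- move=> p cp pm; rewrite /pt_value !nth_cat sc c1 (ltnW c1).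
  rewrite !ltnNge cp (leqW cp) /= -/(key _) -/(key _) subSn //.
  have srt : sorted (fun x y => key x <= key y) l.
    by apply: sort_sorted => x y; apply: leq_total.
  apply: (sorted_ltn_nth _ x0 srt); rewrite ?inE ?sl //; last 2 first.
  + lia.
  + lia.
  by move=> y x z; apply: leq_trans.
- exact: fP.
- apply: shP => // p /andP[cp pm]; apply: degP.
    by apply/slY/mem_nth; rewrite ssl.
  rewrite nth_cat sc ltnNge cp /=.
  by have /eP/andP[] : nth x0 l (p - c) \in l by apply: mem_nth; rewrite sl; lia.
- move=> n /bP; apply: leq_trans; apply/subset_leq_card/trianglesS.
  by apply/subsetP => x; rewrite inE; apply: slY.
Qed.

(** * Recognising cores *)

Lemma in_set3 x y z v : (v \in [set x; y; z]) = (v \in [:: x; y; z]).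
Proof. by rewrite !inE orbA. Qed.

Lemma triangles_set3 Y x y z : [set x; y; z] \in triangles Y ->
  [/\ uniq [:: x; y; z], {subset [:: x; y; z] <= Y} & tri x y z].
Proof.
move=> tY; have u : uniq [:: x; y; z].
  apply/card_uniqP; rewrite -[RHS](card_triangles tY); apply: eq_card => v.
  by rewrite in_set3.
move: tY; rewrite inE triangle3 // => /andP[t /subsetP sY]; split=> // v.
by rewrite -in_set3; apply: sY.
Qed.

Lemma bowtie_of_triangles Y S S' : S \in triangles Y -> S' \in triangles Y ->
  #|S :&: S'| = 1 -> has_core bowtie 5 Y.
Proof.
move=> SY SY' /eqP/cards1P[p Ep].
have [pS pS'] : p \in S /\ p \in S'.
  by apply/andP; rewrite -in_setI Ep inE.
have rest U : U \in triangles Y -> p \in U ->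
    exists x y, U = [set p; x; y].
  move=> UY pU; have := card_triangles UY; rewrite (cardsD1 p) pU => -[] /eqP.
  by move=> /cards2P[x [y [_ E]]]; exists x, y; rewrite -setUA -E setD1K.
have [x [y ES]] := rest _ SY pS; have [z [w ES']] := rest _ SY' pS'.
rewrite ES in SY Ep; rewrite ES' in SY' Ep.
have [u uY t] := triangles_set3 SY; have [u' uY' t'] := triangles_set3 SY'.
apply/has_coreP; exists [:: p; x; y; z; w]; split=> //.
- have I v : v \in [:: x; y] -> v \notin [:: z; w].
    move=> vxy; apply/negP => vzw.
    have : v \in [set p; x; y] :&: [set p; z; w].
      by rewrite inE !in_set3 !(in_cons p) vxy vzw !orbT.
    rewrite Ep inE => /eqP vp; move: u; rewrite -vp /= => /andP[].
    by rewrite vxy.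
  move: u u' (I x) (I y); rewrite /= !inE !eqxx !orbT !negb_or !andbT.
  move=> /andP[/andP[-> ->] ->] /andP[/andP[-> ->] ->] /(_ isT)/andP[-> ->].
  by move=> /(_ isT)/andP[-> ->].
- move=> v; rewrite inE => /predU1P[->|]; first by apply: uY; rewrite inE eqxx.
  rewrite -[[:: x, y & _]]/([:: x; y] ++ [:: z; w]) mem_cat => /orP[] h.
    by apply: uY; rewrite inE h orbT.
  by apply: uY'; rewrite inE h orbT.
- by rewrite /= !value_eq0 t t'.
Qed.

Lemma disjoint_pair_of_triangles Y S S' :
    S \in triangles Y -> S' \in triangles Y -> S :&: S' = set0 ->
  has_core disjoint_pair 6 Y.
Proof.
move=> SY SY' E0.
have three U : U \in triangles Y -> exists x y z, U = [set x; y; z].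
  move=> UY; have := card_triangles UY; have : U != set0.
    by apply/eqP => U0; have := card_triangles UY; rewrite U0 cards0.
  case/set0Pn => x xU; rewrite (cardsD1 x) xU => -[] /eqP.
  by move=> /cards2P[y [z [_ E]]]; exists x, y, z; rewrite -setUA -E setD1K.
have [x [y [z ES]]] := three _ SY; have [x' [y' [z' ES']]] := three _ SY'.
rewrite ES in SY E0; rewrite ES' in SY' E0.
have [u uY t] := triangles_set3 SY; have [u' uY' t'] := triangles_set3 SY'.
apply/has_coreP; exists ([:: x; y; z] ++ [:: x'; y'; z']); split=> //.
- rewrite cat_uniq u u' andbT; apply/hasPn => v v'S; apply/negP => vS.
  have : v \in [set x; y; z] :&: [set x'; y'; z'].
    by rewrite inE !in_set3 vS.
  by rewrite E0 inE.
- by move=> v; rewrite mem_cat => /orP[/uY|/uY'].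
- by rewrite /= !value_eq0 t t'.
Qed.

Lemma fan_of_tri Y x y z w : uniq [:: x; y; z; w] ->
    {subset [:: x; y; z; w] <= Y} -> tri x y z -> tri x y w -> tri x z w ->
  has_core fan 4 Y.
Proof.
move=> u sY t1 t2 t3; apply/has_coreP; exists [:: x; y; z; w]; split=> //.
by rewrite /= !value_eq0 t1 t2 t3.
Qed.

Lemma quads_nth s q : uniq s -> q \in quads (size s) ->
  exists a b c d,
    [/\ uniq [:: a; b; c; d], {subset [:: a; b; c; d] <= s}
      & map (pt_value s) q =
          [:: value a b c; value a b d; value a c d; value b c d]].
Proof.
move=> us /allpairsPdep[d [[[a b] c] []]]; rewrite mem_iota.
rewrite mem_triples => dm abcd ->.
exists (nth x0 s a), (nth x0 s b), (nth x0 s c), (nth x0 s d).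
have [sa sb sc sd] : [/\ a < size s, b < size s, c < size s & d < size s].
  by split; lia.
split=> //; first by rewrite /= !inE !nth_uniq //; lia.
by move=> v; rewrite !inE => /or4P[] /eqP->; apply: mem_nth.
Qed.

Lemma metrizable4_quads s : uniq s ->
  {in quads (size s), forall q, metrizable4 (map (pt_value s) q)}.
Proof.
move=> us q /(quads_nth us)[a [b [c [d [u _ ->]]]]].
exact: metrizable4_faces.
Qed.

Lemma few_triangles4_quads Y s : ~~ has_core fan 4 Y -> uniq s ->
    {subset s <= Y} ->
  {in quads (size s), forall q, few_triangles4 (map (pt_value s) q)}.
Proof.
move=> noA us sY q /(quads_nth us)[a [b [c [d [u abcds ->]]]]].
rewrite /few_triangles4 metrizable4_faces //=.
have noF x y z w : perm_eq [:: x; y; z; w] [:: a; b; c; d] ->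
    ~~ [&& tri x y z, tri x y w & tri x z w].
  move=> p; apply/negP => /and3P[t1 t2 t3]; move/negP: noA; apply.
  apply: (fan_of_tri _ _ t1 t2 t3); first by rewrite (perm_uniq p).
  by move=> v; rewrite (perm_mem p) => /abcds/sY.
(* Three triangular faces omit at most the face opposite their common vertex, so each vertex is put
   first in turn. *)
have := noF a b c d (perm_refl _).
have := noF b a c d ltac:(by apply/permP => P /=; lia).
have := noF c a b d ltac:(by apply/permP => P /=; lia).
have := noF d a b c ltac:(by apply/permP => P /=; lia).
rewrite !value_eq0 (triC b a c) (triC b a d).
rewrite (triC c a b) (triCA a c b) (triC c a d) (triC c b d).
rewrite (triC d a b) (triCA a d b) (triC d a c) (triCA a d c).
rewrite (triC d b c) (triCA b d c).
by case: (tri a b c); case: (tri a b d); case: (tri a c d); case: (tri b c d).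
Qed.

Lemma meet_once_bowtie Y s t t' : uniq s -> {subset s <= Y} ->
    t \in triples (size s) -> t' \in triples (size s) ->
    meet_once t t' -> pt_value s t = 0 -> pt_value s t' = 0 ->
  has_core bowtie 5 Y.
Proof.
move=> us sY ts ts' /eqP m1 t0 t0'.
apply: (@bowtie_of_triangles Y (pt_set s t) (pt_set s t'));
  rewrite ?pt_set_triangle ?t0 ?t0' //.
rewrite -m1 -size_filter; set P := filter _ _.
have Ps p : p \in P -> p < size s.
  by rewrite mem_filter => /andP[_]; apply: points_lt ts.
have uP : uniq (map (nth x0 s) P).
  rewrite map_inj_in_uniq => [|p q /Ps ps /Ps qs /eqP]; last first.
    by rewrite nth_uniq // => /eqP.
  by apply/filter_uniq/(sorted_uniq ltn_trans ltnn)/points_sorted/ts.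
rewrite -(size_map (nth x0 s)) -(card_uniqP uP); apply: eq_card => v.
rewrite in_setI; apply/andP/mapP => [[]|[p pP ->]].
  rewrite inE => /mapP[p pt ->].
  rewrite mem_pt_set ?(points_lt ts pt) // => pt'.
  by exists p; rewrite // mem_filter pt'.
by rewrite !mem_pt_set ?Ps //; move: pP; rewrite mem_filter => /andP[].
Qed.

(** Two triangles through a point that lies in at most one triangle coincide. *)
Lemma meet_from_star Y s c t t' : uniq s -> {subset s <= Y} ->
    (forall p, c <= p < size s -> #|star Y (nth x0 s p)| <= 1) ->
    t \in triples (size s) -> t' \in triples (size s) -> t != t' ->
    meet_from c t t' -> pt_value s t = 0 -> pt_value s t' = 0 ->
  False.
Proof.
move=> us sY degP ts ts' tt' /hasP[p pt /andP[cp pt']] t0 t0'.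
have ps := points_lt ts pt.
have /card_le1_eqP le1 : #|star Y (nth x0 s p)| <= 1 by rewrite degP ?cp.
move/eqP: tt'; apply; apply: (pt_set_inj us) => //.
by apply: le1; rewrite inE ?pt_set_triangle ?t0 ?t0' ?mem_pt_set.
Qed.

(** * The lower bound *)

Definition spread Y : bool :=
  [|| has_core fan 4 Y, has_core bowtie 5 Y | has_core disjoint_pair 6 Y].

Definition light_off c Y s : Prop :=
  [/\ uniq s, size s = c, {subset s <= Y}
    & forall x, x \in Y -> x \notin s -> #|star Y x| <= 1].

Lemma fan_excluded Y s : light_off 4 Y s ->
    all (fun t => pt_value s t == 0) fan ->
  6 < #|Y| -> 2 * #|Y| <= #|triangles Y| + 10.
Proof.
move=> [us ss sY degP] coreP Y7; rewrite leqNgt; apply/negP => few.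
have run m b : 4 <= m <= #|Y| ->
    (forall n, b = Some n -> #|triangles Y| <= n) ->
    core_search m 4 fan metrizable4 (meet_from 4) b.
  move=> mY bP; apply: (core_search_extension _ mY _ us ss sY) => //.
  - exact/allP.
  - by move=> l ul <- _; apply: metrizable4_quads.
  - move=> l ul <- lY degl t t' ts ts' tt'.
    exact: (meet_from_star ul lY degl ts ts' tt').
(* From nine points on, the fan and five further points already give a contradiction; on 8 and 7
   points [few] supplies the bounds 5 and 3. *)
have [Y9|Y9] := leqP 9 #|Y|.
  by apply: (negP (negbT fan_search9)); apply: run; rewrite ?Y9.
have [Y8|Y8] := eqVneq #|Y| 8.
  by apply: (negP (negbT fan_search8)); apply: run => [|n [<-]]; lia.
by apply: (negP (negbT fan_search7)); apply: run => [|n [<-]]; lia.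
Qed.

Lemma bowtie_excluded Y s : ~~ has_core fan 4 Y -> light_off 5 Y s ->
    all (fun t => pt_value s t == 0) bowtie ->
  6 < #|Y| -> 2 * #|Y| <= #|triangles Y| + 10.
Proof.
move=> noA [us ss sY degP] coreP Y7; rewrite leqNgt; apply/negP => few.
have run m b : 5 <= m <= #|Y| ->
    (forall n, b = Some n -> #|triangles Y| <= n) ->
    core_search m 5 bowtie few_triangles4 (meet_from 5) b.
  move=> mY bP; apply: (core_search_extension _ mY _ us ss sY) => //.
  - exact/allP.
  - by move=> l ul <- lY; apply: (few_triangles4_quads noA).
  - move=> l ul <- lY degl t t' ts ts' tt'.
    exact: (meet_from_star ul lY degl ts ts' tt').
have [Y8|Y8] := leqP 8 #|Y|.
  by apply: (negP (negbT bowtie_search8)); apply: run; rewrite ?Y8.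
by apply: (negP (negbT bowtie_search7)); apply: run => [|n [<-]]; lia.
Qed.

Lemma disjoint_pair_excluded Y s : ~~ has_core fan 4 Y ->
    ~~ has_core bowtie 5 Y -> light_off 6 Y s ->
    all (fun t => pt_value s t == 0) disjoint_pair ->
  6 < #|Y| -> False.
Proof.
move=> noA noB [us ss sY degP] coreP Y7.
suff: core_search 7 6 disjoint_pair few_triangles4 meet_once None.
  by rewrite disjoint_pair_search7.
apply: (core_search_extension _ _ _ us ss sY) => //.
- exact/allP.
- by move=> l ul <- lY; apply: (few_triangles4_quads noA).
- move=> l ul <- lY _ t t' ts ts' tt' m1 t0 t0'.
  by move/negP: noB; apply; apply: (meet_once_bowtie ul lY ts ts' m1 t0 t0').
Qed.

(** Either a point outside the chosen core can be removed for the induction, or the situation is one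
    that the searches refute. *)
Lemma core_descent core c Y : has_core core c Y ->
  (exists x, [/\ x \in Y, has_core core c (Y :\ x) & 1 < #|star Y x|]) \/
  (exists s, light_off c Y s /\ all (fun t => pt_value s t == 0) core).
Proof.
move=> /has_coreP[s [us ss sY coreP]].
have [/exists_inP[x xY /andP[xs deg]]|/exists_inPn none] :=
    boolP [exists x in Y, (x \notin s) && (1 < #|star Y x|)].
  left; exists x; split=> //; apply/has_coreP; exists s; split=> // y ys.
  by rewrite !inE sY // andbT; apply: contraNneq xs => <-.
right; exists s; split=> //; split=> // x xY xs.
by have := none x xY; rewrite xs /= -leqNgt.
Qed.

(** This is the base of the induction: 2n - 10 is at most 2 for n up to 6. *)
Lemma spread_two_triangles Y : spread Y -> 1 < #|triangles Y|.
Proof.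
have two core c : (1 < size core) && uniq core && all (mem (triples c)) core ->
    has_core core c Y -> 1 < #|triangles Y|.
  move=> /andP[/andP[core2 ucore] /allP corec].
  case/has_coreP=> s [us ss sY /allP coreP].
  apply: leq_trans core2 _; rewrite -ss in corec.
  apply: leq_trans (count_triangles us sY (leqnn _)).
  rewrite count_map -size_filter.
  apply: uniq_leq_size ucore _ => t tc; rewrite mem_filter /= coreP //.
  exact: corec.
by case/or3P; apply: two.
Qed.

Lemma spread_cosize Y : spread Y -> 2 * #|Y| <= #|triangles Y| + 10.
Proof.
have [k] := ubnP #|Y|; elim: k Y => // k IH Y Yk spY.
have [Y6|Y7] := leqP #|Y| 6.
  by have := spread_two_triangles spY; lia.
(* Removing [x] lowers 2n by 2 and destroys at least two triangles. *)
have step x : x \in Y -> spread (Y :\ x) -> 1 < #|star Y x| ->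
    2 * #|Y| <= #|triangles Y| + 10.
  move=> xY sp deg; have := IH (Y :\ x); have := triangles_setD1 Y x.
  rewrite -/(star Y x); have := cardsD1 x Y; rewrite xY => cY tY /(_ _ sp).
  by move/(_ ltac:(lia)); lia.
(* The order of the cases matters: the bowtie search presupposes that there is no fan, the last
   search that there is neither. *)
have [A|noA] := boolP (has_core fan 4 Y).
  have [[x [xY Ax deg]]|[s [off coreP]]] := core_descent A.
    by apply: (step x) => //; rewrite /spread Ax.
  exact: fan_excluded off coreP Y7.
have [C|noC] := boolP (has_core bowtie 5 Y).
  have [[x [xY Ax deg]]|[s [off coreP]]] := core_descent C.
    by apply: (step x) => //; rewrite /spread Ax orbT.
  exact: bowtie_excluded noA off coreP Y7.
have D : has_core disjoint_pair 6 Y.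
  by move: spY; rewrite /spread (negbTE noA) (negbTE noC).
have [[x [xY Ax deg]]|[s [off coreP]]] := core_descent D.
  by apply: (step x) => //; rewrite /spread Ax !orbT.
by case: (disjoint_pair_excluded noA noC off coreP Y7).
Qed.

(** Triangles that pairwise share two points either all contain one pair, and then the third vertex
    bounds their number by n - 2, or include three that lie on four points. *)
Lemma spread_of_many_triangles Y : 3 < #|Y| -> #|Y| - 2 < #|triangles Y| ->
  spread Y.
Proof.
move=> Y4 manyT.
have [/forall_inP pw|] := boolP [forall S in triangles Y,
    forall S' in triangles Y, (S == S') || (#|S :&: S'| == 2)]; last first.
  rewrite negb_forall_in => /exists_inP[S SY].
  rewrite negb_forall_in => /exists_inP[S' SY'].
  rewrite negb_or => /andP[SS' n2].
  have : #|S :&: S'| <= 3.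
    by rewrite -(card_triangles SY) subset_leq_card ?subsetIl.
  case E: #|S :&: S'| n2 => [|[|[|[|]]]] // _ _; rewrite /spread.
  - rewrite (disjoint_pair_of_triangles SY SY') ?orbT //.
    by apply/eqP; rewrite -cards_eq0 E.
  - by rewrite (bowtie_of_triangles SY SY' E) orbT.
  - have SI : S :&: S' = S.
      by apply/eqP; rewrite eqEcard subsetIl (card_triangles SY) E.
    move/eqP: SS'; case; apply/eqP; rewrite eqEcard (card_triangles SY).
    by rewrite (card_triangles SY') andbT; apply/setIidPl.
have meet2 S S' : S \in triangles Y -> S' \in triangles Y -> S != S' ->
    #|S :&: S'| = 2.
  move=> SY SY' SS'; move/forall_inP: (pw S SY) => /(_ S' SY') /orP[|/eqP //].
  by rewrite (negbTE SS').
have /card_gt1P[S [S' [SY SY' SS']]] : 1 < #|triangles Y| by lia.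
have /eqP/cards2P[a [b [ab EI]]] := meet2 S S' SY SY' SS'.
have third U : U \in triangles Y -> S :&: S' \subset U ->
    exists c, U = [set a; b; c].
  rewrite EI => UY abU; have := card_triangles UY.
  rewrite -(cardsID [set a; b]).
  rewrite (setIidPr abU) cards2 ab => -[] /eqP/cards1P[c Ec]; exists c.
  by rewrite -(setID U [set a; b]) (setIidPr abU) Ec.
have [c ES] := third S SY (subsetIl _ _).
have [d ES'] := third S' SY' (subsetIr _ _).
have [/forall_inP all_ab|] :=
    boolP [forall U in triangles Y, S :&: S' \subset U].
  suff: #|triangles Y| <= #|Y| - 2 by lia.
  have -> : #|Y| - 2 = #|Y :\: [set a; b]|.
    rewrite cardsD (setIidPr _) ?cards2 ?ab // -EI.
    by apply: subset_trans (subsetIl _ _) _; move: SY; rewrite inE => /andP[].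
  apply: leq_trans (leq_imset_card (fun c => [set a; b; c]) _).
  apply/subset_leq_card/subsetP => U UY; have [e Ee] := third U UY (all_ab U UY).
  apply/imsetP; exists e => //; rewrite Ee in UY.
  have [u sY _] := triangles_set3 UY; rewrite inE sY ?inE ?eqxx ?orbT // andbT.
  by move: u; rewrite /= !inE !negb_or !andbT !(eq_sym e) => /andP[/andP[_ ->] ->].
rewrite negb_forall_in => /exists_inP[U UY].
rewrite EI subUset !sub1set negb_and => abU.
rewrite ES in SY SS'; rewrite ES' in SY' SS'.
wlog aU : a b {third EI ab} ES ES' SY SY' SS' abU / a \notin U.
  move=> wl; case/orP: (abU) => [aU|bU]; first exact: (wl a b).
  by apply: (wl b a); rewrite 1?[[set b; a]]setUC 1?orbC.
(* A triangle through [a] meets [U] in two points other than [a], hence in its other two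
   vertices. *)
have both x y : [set a; x; y] \in triangles Y -> (x \in U) && (y \in U).
  move=> T; have aT : a \in [set a; x; y] by rewrite !inE eqxx.
  have TU : [set a; x; y] != U by apply: contraNneq aU => <-.
  have := meet2 _ _ T UY TU; have [u _ _] := triangles_set3 T.
  have sub : [set a; x; y] :&: U \subset [set x; y].
    apply/subsetP => v; rewrite !inE -orbA => /andP[/predU1P[->|//]].
    by rewrite (negbTE aU).
  move=> c2; have E : [set a; x; y] :&: U = [set x; y].
    apply/eqP; rewrite eqEcard sub c2 cards2; by case: (_ == _).
  by rewrite -!sub1set -subUset -E subsetIr.
have /andP[bU cU] := both _ _ SY; have /andP[_ dU] := both _ _ SY'.
have cd : c != d by apply: contraNneq SS' => ->.
have [u sY t] := triangles_set3 SY; have [u' sY' t'] := triangles_set3 SY'.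
have ubcd : uniq [:: b; c; d].
  by move: u u'; rewrite /= !inE !negb_or cd !andbT => /andP[_ ->] /andP[_ ->].
have EU : U = [set b; c; d].
  apply/esym/eqP; rewrite eqEcard (card_triangles UY); apply/andP; split.
    by rewrite !subUset !sub1set bU cU.
  by rewrite (eq_card (in_set3 b c d)) (card_uniqP ubcd).
rewrite EU in UY; have [_ sU tU] := triangles_set3 UY.
(* The triangles abc, abd and bcd form a fan with common vertex [b]. *)
rewrite /spread (@fan_of_tri Y b a c d) // 1?triC //.
  rewrite cons_uniq [uniq _]cons_uniq; move: u u' ubcd.
  rewrite /= !inE !negb_or !andbT (eq_sym b a).
  by move=> /andP[/andP[-> ->] ->] /andP[/andP[_ ->] ->] /andP[_ ->].
move=> v; rewrite !inE => /or4P[] /eqP->;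
  by (apply: sU + apply: sY + apply: sY'); rewrite !inE eqxx ?orbT.
Qed.

End Geometry.

Lemma cosize_lower_bound (B : betweenness) : 3 < #|B| -> #|B| - 2 < cosize B ->
  2 * #|B| <= cosize B + 10.
Proof.
have [x0 _] := card_gt0P (point_nonempty B).
have -> : cosize B = #|triangles [set: B]|.
  by apply: eq_card => S; rewrite !inE subsetT andbT.
rewrite -cardsT => n4 many; apply: (@spread_cosize B x0).
exact: spread_of_many_triangles.
Qed.

(** * Extremal structures *)

Record is_metric n (d : nat -> nat -> nat) : Prop := IsMetric {
  metric_refl : forall i, d i i = 0;
  metric_sym : forall i j, d i j = d j i;
  metric_eq0 : forall i j, i < n -> j < n -> d i j = 0 -> i = j;
  metric_triangle : forall i j k,
    i < n -> j < n -> k < n -> d i k <= d i j + d j k }.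

Definition metric_tri (d : nat -> nat -> nat) (t : triple) : bool :=
  let: (i, j, k) := t in
  ~~ [|| d j k == d j i + d i k, d i k == d i j + d j k
       | d i j == d i k + d k j].

(** Equality in the triangle inequality defines a betweenness. *)
Lemma metric_betweenness n d : 0 < n -> is_metric n d ->
  exists B, in_B n (count (metric_tri d) (triples n)) B.
Proof.
move=> n0 [drefl dsym d0 dtri].
pose b := [set p : 'I_n * 'I_n * 'I_n |
  let: (x, y, z) := p in d x z == d x y + d y z].
have n0' : 0 < #|'I_n| by rewrite card_ord.
have P1 x z : (x, x, z) \in b by rewrite inE drefl.
have P2 x y z : (x, y, z) \in b -> (z, y, x) \in b.
  by rewrite !inE => /eqP E; rewrite (dsym z x) E addnC (dsym z) (dsym y x).
have P3 x y z : (x, y, z) \in b -> (y, x, z) \in b -> x = y.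
  rewrite !inE => /eqP E /eqP E'; apply/val_inj/(d0 _ _ (ltn_ord x) (ltn_ord y)).
  (* Adding the two equalities gives 2 d(x, y) = 0. *)
  by move: E E'; rewrite (dsym y x); lia.
have P4 x y z w : (x, y, z) \in b -> (x, w, y) \in b ->
    (x, w, z) \in b /\ (w, y, z) \in b.
  rewrite !inE => /eqP E /eqP E'.
  (* The path from x through w and y to z has length d(x, z), so neither shortcut, x to w to z or w
     straight to z, can be strictly shorter. *)
  have h1 := dtri _ _ _ (ltn_ord x) (ltn_ord w) (ltn_ord z).
  have h2 := dtri _ _ _ (ltn_ord w) (ltn_ord y) (ltn_ord z).
  by split; apply/eqP; lia.
pose B := Betweenness n0' P1 P2 P3 P4; exists B; split; first exact: card_ord.
rewrite (@cosize_count B (Ordinal n0) (enum 'I_n)) ?enum_uniq //; last first.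
  by move=> x; rewrite mem_enum.
rewrite size_enum_ord count_map; apply: eq_in_count => -[[i j] k].
rewrite mem_triples => ijk /=.
have [ni nj nk] : [/\ i < n, j < n & k < n] by split; lia.
by rewrite value_eq0 /tri !inE !nth_enum_ord.
Qed.

(* Points on a line, except that distinct points at the same place are at
   distance 2. *)
Definition twin_dist (f : nat -> nat) (i j : nat) : nat :=
  if i == j then 0 else if f i == f j then 2 else (f i - f j) + (f j - f i).

(** A detour through a third point costs at least 1 + 1, so 2 is admissible between twins even when
    they have a neighbour at distance 1. *)
Lemma twin_dist_metric n f : is_metric n (twin_dist f).
Proof.
rewrite /twin_dist; split=> [i|i j|i j _ _|i j k _ _ _].
- by rewrite eqxx.
- by rewrite (eq_sym i) (eq_sym (f i)) addnC.
- by do !case: ifP; lia.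
- have [->|ik] := eqVneq i k; first by lia.
  have [<-|_] := eqVneq i j; first by rewrite (negbTE ik).
  have [->|_] := eqVneq j k; first by lia.
  by do !case: ifP; lia.
Qed.

(* The places are 0, 1, 1, 2, 2, 3, 4, 5, ... *)
Definition two_twins i := if i < 2 then i else if i < 4 then i - 1 else i - 2.

(** Points at distance 1 lie between twins, while any farther point forms a triangle with them;
    triples at three distinct places are collinear. Each of the two pairs has three points at
    distance 1, which leaves n - 5 triangles per pair. *)
Lemma two_twins_cosize n : 9 <= n ->
  count (metric_tri (twin_dist two_twins)) (triples n) = 2 * n - 10.
Proof.
elim: n => // n IH; rewrite leq_eqVlt => /predU1P[<-|n9]; first by vm_compute.
rewrite triplesS count_cat IH // count_map.
(* The new last point is far from both twin pairs, and its only triangles are those with [(1, 2)]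
   and [(3, 4)]. *)
rewrite (eq_in_count (a2 := predU (pred1 (1, 2)) (pred1 (3, 4)))); last first.
  move=> [i j]; rewrite mem_pairs /= => ijn; rewrite !xpair_eqE.
  have [ij jn] := andP ijn.
  have mono u v : u <= v -> two_twins u <= two_twins v.
    by rewrite /two_twins; do !case: ifP; lia.
  have fn : two_twins n.-1 < two_twins n.
    by rewrite /two_twins; do !case: ifP; lia.
  have fjn : two_twins j < two_twins n by apply: leq_ltn_trans fn; apply: mono; lia.
  have dE u v : u < v -> two_twins u < two_twins v ->
      twin_dist two_twins u v = two_twins v - two_twins u.
    by move=> uv fuv; rewrite /twin_dist !ltn_eqF //; lia.
  have dC := metric_sym (twin_dist_metric 0 two_twins).
  rewrite (dC j i) (dC n j) (dE j n) // (dE i n) ?(ltn_trans ij) //; last first.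
    exact: leq_ltn_trans (mono _ _ (ltnW ij)) fjn.
  have [fij|fij] := eqVneq (two_twins i) (two_twins j).
    have -> : twin_dist two_twins i j = 2 by rewrite /twin_dist (ltn_eqF ij) fij eqxx.
    have : ((i == 1) && (j == 2)) || ((i == 3) && (j == 4)).
      by move: fij; rewrite /two_twins; do !case: ifP; lia.
    have fn7 : 7 <= two_twins n by rewrite /two_twins; do !case: ifP; lia.
    have f2 : ((i == 1) && (j == 2)) || ((i == 3) && (j == 4)) -> two_twins j <= 2.
      by case/orP=> /andP[_ /eqP->].
    by rewrite fij => /[dup] /f2 fj2 ->; lia.
  have {}fij : two_twins i < two_twins j by rewrite ltn_neqAle fij mono // ltnW.
  rewrite (dE i j) // (_ : _ || _ = true); last first.
    by move: (two_twins i) (two_twins j) (two_twins n) fij fjn; lia.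
  apply/esym/negbTE/negP => /orP[] /andP[/eqP i0 /eqP j0];
    by rewrite i0 j0 in fij.
have := count_predUI (pred1 (1, 2)) (pred1 (3, 4)) (pairs n).
rewrite !(count_uniq_mem _ (pairs_uniq n)) !mem_pairs.
rewrite (@eq_count _ (predI _ _) pred0) ?count_pred0; last first.
  by move=> [i j] /=; rewrite !xpair_eqE; lia.
lia.
Qed.

Lemma small_cosize n : 4 <= n <= 8 -> exists B, in_B n (n - 1) B.
Proof.
have twins s :
    count (metric_tri (twin_dist (nth 0 s))) (triples (size s)) = size s - 1 ->
    0 < size s -> exists B, in_B (size s) (size s - 1) B.
  by move=> <- s0; apply: metric_betweenness s0 (twin_dist_metric _ _).
move: n => [|[|[|[|[|[|[|[|[|//]]]]]]]]] // _.
(* Distances 1 and 2 always satisfy the triangle inequality. Only the pairs 1, 3 and 2, 3 are at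
   distance 1, so [(1, 2, 3)] is the one collinear triple. *)
- pose d i j := if i == j then 0 else if 4 <= i + j then 1 else 2.
  apply: (@metric_betweenness 4 d) => //; split=> [i|i j|i j _ _|i j k _ _ _].
  + by rewrite /d eqxx.
  + by rewrite /d (eq_sym i) addnC.
  + by rewrite /d; do !case: ifP; lia.
  + by rewrite /d; do !case: ifP; lia.
(* In these lists of places the two twin pairs contribute 2 + 2, 3 + 2, 3 + 3 and 4 + 3
   triangles. *)
- exact: (twins [:: 0; 0; 1; 2; 2]).
- exact: (twins [:: 0; 0; 1; 2; 2; 3]).
- exact: (twins [:: 0; 1; 1; 2; 3; 3; 4]).
- exact: (twins [:: 0; 0; 1; 1; 2; 3; 4; 5]).
Qed.

Theorem theorem5 (n : nat) (hn : 4 <= n) :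
  is_tau n (n - 2) (if 9 <= n then 2 * n - 10 else n - 1).
Proof.
have [n9|n8] := leqP 9 n; split; try lia.
- rewrite -two_twins_cosize //; apply: metric_betweenness; first lia.
  exact: twin_dist_metric.
- move=> m nm [B [Bn Bm]]; rewrite /bt_order in Bn.
  by have := @cosize_lower_bound B; rewrite Bn Bm; lia.
(* Minimality is immediate, since n - 1 is the first integer above n - 2; only existence remains. *)
- by apply: small_cosize; rewrite hn.
Qed.
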